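(* Let $n\ge 3$, let $a_0,\ldots,a_{n-1}$ be indeterminates over $\mathbb{Q}$, $f=x^n+a_{n-1}x^{n-1}+\cdots+a_0$, \[f_1(x,y)=\frac{f(y)-f(x)}{y-x},\qquad f_3(x,y)=\frac{f(y)-2f\left(\frac{x+y}{2}\right)+f(x)}{\frac{(y-x)^2}{2}},\] and $E=\operatorname{res}(f,\operatorname{res}(f_1,f_3,y),x)\in\mathbb{Q}[a_0,\ldots,a_{n-1}]$. Then the total degree of $E$ in $(a_0,\ldots,a_{n-1})$ equals $3(n-1)(n-2)$.
   Context: $\operatorname{res}$ is the Sylvester resultant with respect to the indicated variable. *)

(* Defs.v *)
From HB Require Import structures.
From mathcomp Require Import all_boot all_order all_algebra.
From mathcomp Require Import mpoly.
Set Implicit Arguments. Unset Strict Implicit. Unset Printing Implicit Defensive.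
Import Order.TTheory GRing.Theory Num.Theory.
Local Open Scope ring_scope.

Notation Qa n := {mpoly rat[n]}.

Definition genf (n : nat) : {poly Qa n} :=
  'X^n + \sum_(i < n) ('X_i)%:P * 'X^i.

(* Bivariate polynomials: outer variable y, inner variable x,
   i.e. elements of (Q[a][x])[y]. *)
Definition fy n : {poly {poly Qa n}} := map_poly polyC (genf n).
Definition fx n : {poly {poly Qa n}} := (genf n)%:P.
Definition Xin n : {poly {poly Qa n}} := ('X : {poly Qa n})%:P.
Definition half n : {poly {poly Qa n}} := ((2%:R : rat)^-1)%:MP%:P%:P.
Definition fmid n : {poly {poly Qa n}} := fy n \Po (('X + Xin n) * half n).

(* f_1 = (f(y) - f(x)) / (y - x)   (exact division) *)
Definition f1 n : {poly {poly Qa n}} := (fy n - fx n) %/ ('X - Xin n).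
(* f_3 = (f(y) - 2 f((x+y)/2) + f(x)) / ((y-x)^2/2)   (exact division) *)
Definition f3 n : {poly {poly Qa n}} :=
  (2%:R * (fy n - 2%:R * fmid n + fx n)) %/ (('X - Xin n) ^+ 2).

Definition Eres n : Qa n := resultant (genf n) (resultant (f1 n) (f3 n)).

(* Main.v *)
Require Import Defs.
From HB Require Import structures.
From mathcomp Require Import all_boot all_order all_algebra.
From mathcomp Require Import all_field.
From mathcomp Require Import mpoly ring zify.
Set Implicit Arguments. Unset Strict Implicit. Unset Printing Implicit Defensive.
Import Order.TTheory GRing.Theory Num.Theory.
Local Open Scope ring_scope.

(** Let r_1, ..., r_n be the roots of f. Since f_1(r_i, y) is the product of the
    y - r_j for j <> i, and f_3(r_i, r_j) = -4 f((r_i + r_j)/2) / (r_j - r_i)^2,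
    where the factors k = i, j of f((r_i + r_j)/2) cancel the denominator,
      E = +/- prod_(i, j, k distinct) ((r_i + r_j)/2 - r_k).
    Evaluate E at the coefficients of (x - t) h(x), with h monic of degree n - 1
    and constant coefficients. They have the form b + t c, where c is -h, so the
    coefficient of t^d, for d the total degree of E, is the value at c of the
    top homogeneous part of E. For a suitable rational h this value is not 0
    and the degree in t is d; by the product formula it is also the number of
    triples of distinct indices that contain the index of the root t, which is
    3(n-1)(n-2). *)

(** * Resultants as products over the roots of the first polynomial *)

(** Row k of a Sylvester block holds the coefficients of ['X^k * p], so its product with the column
    of powers of [x] is x^k p(x); [N] is large enough to lose no coefficient. *)
Lemma horner_shift (R : comNzRingType) (p : {poly R}) (x : R) k N :
  (k + size p <= N)%N ->
  \sum_(a < N) (p`_(a - k) *+ (k <= a)) * x ^+ a = x ^+ k * p.[x].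
Proof.
move=> le_N; have -> : x ^+ k * p.[x] = ('X^k * p).[x].
  by rewrite hornerM hornerXn.
rewrite (@horner_coef_wide _ N); last first.
  by rewrite (leq_trans (size_polyMleq _ _)) // size_polyXn.
by apply: eq_bigr => a _; rewrite coefXnM ltnNge if_neg -mulrb.
Qed.

Lemma Sylvester_mxEu (R : nzRingType) (p q : {poly R}) i j :
  Sylvester_mx p q (lshift _ i) j = p`_(j - i) *+ (i <= j).
Proof. by rewrite Sylvester_mxE (unsplitK (inl i)). Qed.

Lemma Sylvester_mxEd (R : nzRingType) (p q : {poly R}) i j :
  Sylvester_mx p q (rshift _ i) j = q`_(j - i) *+ (i <= j).
Proof. by rewrite Sylvester_mxE (unsplitK (inr i)). Qed.

(* Multiply the Sylvester matrix on the right by (I ; 0 | (r_k^a)_(a, k)): the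
   upper right block vanishes, the lower right one is a Vandermonde matrix with
   columns scaled by q(r_k), and the upper left one is triangular with p(0) on
   the diagonal. Distinct nonzero roots allow the cancellation of the
   determinant of the multiplier. *)
Lemma resultant_prod_XsubC_ord (R : idomainType) (p q : {poly R})
    (r : 'I_(size p).-1 -> R) :
  p = \prod_i ('X - (r i)%:P) -> injective r -> (forall i, r i != 0) ->
  resultant p q = \prod_i ((-1) ^+ (size q).-1 * q.[r i]).
Proof.
move=> def_p r_inj r_neq0.
have p_neq0 : p != 0.
  by rewrite def_p; apply/prodf_neq0 => i _; rewrite polyXsubC_eq0.
have root_p k : p.[r k] = 0.
  rewrite def_p horner_prod (bigD1 k) //= !hornerE /= subrr mul0r //.
pose l := (size q).-1; pose m := (size p).-1.
pose S : 'M_(l + m) := Sylvester_mx p q.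
pose Wr : 'M_(l + m, m) := \matrix_(a, k) r k ^+ a.
pose W : 'M_(l + m) := row_mx (col_mx 1%:M 0) Wr.
pose V : 'M_m := Vandermonde m (\row_k r k).
pose D := diag_mx (\row_(k < m) q.[r k]).
pose L := diag_mx (\row_(k < m) r k ^+ l).
have defSW : S *m Wr = col_mx 0 (V *m D).
  apply/matrixP=> i k; rewrite -[i]splitK.
  transitivity (\sum_j S (unsplit (split i)) j * r k ^+ j).
    by rewrite mxE; apply: eq_bigr => j _; rewrite [Wr _ _]mxE.
  case: (split i) => {}i /=.
    rewrite col_mxEu mxE; under eq_bigr do rewrite Sylvester_mxEu.
    rewrite horner_shift ?root_p ?mulr0 //.
    by rewrite (polySpred p_neq0) addnS -addSn leq_add2r.
  rewrite col_mxEd mul_mx_diag !mxE.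
  under eq_bigr do rewrite Sylvester_mxEd.
  rewrite horner_shift //.
  rewrite (leq_trans (leq_add (leqnn _) (leqSpred _))) //.
  by rewrite addnS -addSn addnC leq_add2l.
have defW : W = block_mx 1%:M (usubmx Wr) 0 (V *m L).
  rewrite block_mxEh /W; congr row_mx; rewrite -[LHS]vsubmxK; congr col_mx.
  apply/matrixP=> i k; rewrite mul_mx_diag !mxE.
  by rewrite /= exprD mulrC.
have detA : \det (usubmx (lsubmx S)) = \prod_k (- r k) ^+ l.
  have ES i j : usubmx (lsubmx S) i j = p`_(j - i) *+ (i <= j).
    by rewrite 2!mxE Sylvester_mxEu.
  rewrite -det_tr det_trig; last first.
    by apply/is_trig_mxP=> i j lt_ij; rewrite mxE ES leqNgt lt_ij.
  rewrite prodrXl.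
  transitivity (\prod_(i < l) p`_0).
    by apply: eq_bigr => i _; rewrite mxE ES leqnn subnn.
  rewrite prodr_const card_ord; congr (_ ^+ _).
  rewrite -horner_coef0 (congr1 (horner^~ 0) def_p) horner_prod.
  by apply: eq_bigr => k _; rewrite !hornerE.
have := congr1 determinant (mul_mx_row S (col_mx 1%:M 0) Wr).
rewrite -/W det_mulmx defW det_ublock det1 mul1r det_mulmx.
have -> : S *m col_mx 1%:M 0 = lsubmx S.
  by rewrite -{1}[S]hsubmxK mul_row_col mulmx1 mulmx0 addr0.
rewrite defSW -[lsubmx S]vsubmxK -block_mxEh det_lblock detA det_mulmx.
rewrite -/(resultant p q) => det_eq.
have detV : \det V != 0.
  rewrite det_Vandermonde; apply/prodf_neq0 => i _; apply/prodf_neq0 => j ltij.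
  by rewrite !mxE subr_eq0 (inj_eq r_inj) eq_sym neq_ltn ltij.
have detL : \prod_k r k ^+ l != 0.
  by apply/prodf_neq0 => i _; rewrite expf_neq0.
have EL : \det L = \prod_k r k ^+ l.
  by rewrite det_diag; apply: eq_bigr => k _; rewrite mxE.
have ED : \det D = \prod_k q.[r k].
  by rewrite det_diag; apply: eq_bigr => k _; rewrite mxE.
apply: (mulIf detV); apply: (mulIf detL); move: det_eq.
rewrite EL ED mulrA => ->.
rewrite big_split /= -!mulrA; under eq_bigr do rewrite exprNn.
rewrite big_split /= -!mulrA; congr (_ * _).
by rewrite mulrC -!mulrA; rewrite [RHS]mulrCA.
Qed.

(** With the roots in a list, the formula also serves for a product over some of the indices only,
    such as all j <> i. *)
Lemma resultant_prod_XsubC (R : idomainType) (rs : seq R) (q : {poly R}) :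
  uniq rs -> 0 \notin rs ->
  resultant (\prod_(z <- rs) ('X - z%:P)) q =
    \prod_(z <- rs) ((-1) ^+ (size q).-1 * q.[z]).
Proof.
set p := \prod_(z <- rs) _ => rs_uniq rs_neq0.
have sz_p : (size p).-1 = size rs.
  by rewrite /p size_prod_XsubC.
rewrite (@resultant_prod_XsubC_ord _ p q (fun i => rs`_i)).
- by rewrite [RHS](big_nth 0) big_mkord -sz_p.
- by rewrite {1}/p (big_nth 0) big_mkord -sz_p.
- move=> i j /eqP; rewrite nth_uniq -?sz_p //.
  by move/eqP/val_inj.
- move=> i; apply: contraNneq rs_neq0 => <-.
  by rewrite mem_nth // -sz_p.
Qed.

(** Nonzero images of the leading coefficients preserve both sizes, hence the shape of the Sylvester
    matrix. The morphism may have a kernel, as the specialization of x at a root does. *)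
Lemma map_resultant_lead (aR rR : nzRingType) (f : {rmorphism aR -> rR}) p q :
    f (lead_coef p) != 0 -> f (lead_coef q) != 0 ->
  f (resultant p q) = resultant (map_poly f p) (map_poly f q).
Proof.
move=> nz_fp nz_fq; rewrite /resultant /Sylvester_mx !size_map_poly_id0 //.
rewrite -det_map_mx /= map_col_mx; congr (\det (col_mx _ _));
  by apply: map_lin1_mx => v; rewrite map_poly_rV rmorphM /= map_rVpoly.
Qed.

(** * The generic polynomial f and the exact quotients f_1 and f_3 *)

Lemma size_genf n : size (genf n) = n.+1.
Proof.
rewrite /genf size_polyDl size_polyXn // ltnS.
apply: (leq_trans (size_sum _ _ _)); apply/bigmax_leqP => i _.
rewrite mul_polyC (leq_trans (size_scale_leq _ _)) // size_polyXn.
exact: ltn_ord.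
Qed.

Lemma coef_genf n (i : 'I_n) : (genf n)`_i = 'X_i.
Proof.
rewrite coefD coefXn ltn_eqF // add0r coef_sum (bigD1 i) //= big1 => [|j neq_ji].
  by rewrite coefCM coefXn eqxx mulr1 addr0.
rewrite coefCM coefXn; case: eqP => [/val_inj eq_ij|]; last by rewrite mulr0.
by rewrite eq_ij eqxx in neq_ji.
Qed.

Lemma monic_genf n : genf n \is monic.
Proof.
rewrite monicE lead_coefE size_genf coefD coefXn eqxx coef_sum big1 ?addr0 //.
by move=> i _; rewrite coefCM coefXn gtn_eqF // mulr0.
Qed.

Lemma horner_polyCX (R : comNzRingType) (p : {poly R}) :
  (map_poly polyC p).['X] = p.
Proof. exact: comp_polyXr. Qed.

(* Hides the concrete rational 1/2 behind a variable: unification would otherwise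
   evaluate it. *)
Lemma halfP n :
  exists c : {poly Qa n}, [/\ Defs.half n = c%:P, c + c = 1 & c = (2%:R^-1)%:MP%:P].
Proof.
exists (2%:R^-1)%:MP%:P; split=> //.
have : 2%:R^-1 + 2%:R^-1 = 1 :> rat by [].
by move: (2%:R^-1 : rat) => c cE; rewrite -polyCD -mpolyCD cE mpolyC1 polyC1.
Qed.

Lemma horner_mid n : (('X + Xin n) * Defs.half n).['X] = 'X.
Proof.
have [c [-> cE _]] := halfP n.
by rewrite hornerM hornerD hornerX !hornerC -[RHS]mulr1 mulrDl -mulrDr cE.
Qed.

Lemma horner_fmid n : (fmid n).['X] = genf n.
Proof. by rewrite horner_comp horner_mid horner_polyCX. Qed.

Lemma f1M n : f1 n * ('X - Xin n) = fy n - fx n.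
Proof.
have /factor_theorem[p def_p] : root (fy n - fx n) 'X.
  by rewrite /root hornerD hornerN hornerC horner_polyCX subrr.
by rewrite /f1 def_p Pdiv.IdomainMonic.mulpK ?monicXsubC.
Qed.

Lemma factor_theorem2 (R : comNzRingType) (p : {poly R}) (c : R) :
  p.[c] = 0 -> p^`().[c] = 0 -> exists q, p = q * ('X - c%:P) ^+ 2.
Proof.
move=> /eqP/factor_theorem[q ->].
rewrite derivM derivXsubC mulr1 hornerD hornerM hornerXsubC subrr mulr0 add0r.
by move=> /eqP/factor_theorem[s ->]; exists s; rewrite -mulrA -expr2.
Qed.

(** The division is exact because y = x is a double root of the numerator: the derivative in y at y
    = x is a multiple of f'(x) - 2 (1/2) f'(x) = 0. *)
Lemma f3M n :
  f3 n * ('X - Xin n) ^+ 2 = 2%:R * (fy n - 2%:R * fmid n + fx n).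
Proof.
rewrite /f3; set N := 2%:R * _.
have [||q ->] := @factor_theorem2 _ N 'X; last first.
- by rewrite Pdiv.IdomainMonic.mulpK // monic_exp // monicXsubC.
- have hM := horner_mid n; have [c [defc cE _]] := halfP n.
  rewrite /N -polyC_natr derivM derivC mul0r add0r derivD derivB derivM.
  rewrite !derivC mul0r add0r addr0 deriv_comp.
  rewrite !(hornerM, hornerD, hornerN) horner_comp hM defc derivM derivC.
  rewrite mulr0 addr0 derivD derivX derivC addr0 mul1r !hornerC.
  set d := (_^`()).[_]; have -> : 2%:R * (d * c) = d.
    by rewrite mulr_natl mulr2n -mulrDr cE mulr1.
  by rewrite subrr mulr0.
- rewrite /N -polyC_natr !(hornerM, hornerD, hornerN) !hornerC horner_fmid.
  by rewrite horner_polyCX; ring.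
Qed.

(** Leading coefficient of f_3 in y for n >= 2: the 1 comes from f(y), the power of 1/2 from f((x +
    y)/2), and the outer 2 from the denominator (y - x)^2/2. *)
Definition f3_lead n : rat := 2%:R * (1 - 2%:R * 2%:R^-1 ^+ n).

(** For n >= 2 one has 2 * 2^-n <= 1/2 < 1, whereas n = 1 would give 0. *)
Lemma f3_lead_neq0 n : (1 < n)%N -> f3_lead n != 0.
Proof.
move=> n_gt1; rewrite mulf_neq0 // subr_eq0 eq_sym.
rewrite -(subnK n_gt1) exprD mulrCA.
have h : (2%:R^-1 : rat) ^+ (n - 2) <= 1 by rewrite exprn_ile1.
rewrite lt_eqF //; apply: (@le_lt_trans _ _ (1 * (2%:R * 2%:R^-1 ^+ 2))) => //.
by rewrite ler_wpM2r.
Qed.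

Lemma size_mid n : size (('X + Xin n) * Defs.half n) = 2.
Proof.
have [c [-> cE _]] := halfP n; rewrite mulrC mul_polyC size_scale ?size_XaddC //.
by apply: contra_eq_neq cE => ->; rewrite addr0 eq_sym oner_eq0.
Qed.

Lemma coef_fmid n : (fmid n)`_n = (2%:R^-1 ^+ n)%:MP%:P.
Proof.
have szf : size (fy n) = n.+1 by rewrite size_map_polyC size_genf.
have szm : size (fmid n) = n.+1 by rewrite size_comp_poly2 ?size_mid.
transitivity (lead_coef (fmid n)); first by rewrite lead_coefE szm.
rewrite lead_coef_comp ?size_mid // szf /= lead_coef_map_inj ?raddf0 //; last first.
  exact: polyC_inj.
have [c [-> _ ->]] := halfP n; move: (2%:R^-1 : rat) => {}c.
rewrite (eqP (monic_genf n)) mul1r mulrC mul_polyC lead_coefZ lead_coefXaddC.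
by rewrite mulr1 !rmorphXn.
Qed.

(** The numerator has degree exactly n in y, and division by the monic square lowers the degree by 2
    and keeps the leading coefficient. *)
Lemma lead_coef_size_f3 n : (1 < n)%N ->
  lead_coef (f3 n) = (f3_lead n)%:MP%:P /\ size (f3 n) = n.-1.
Proof.
move=> n_gt1.
have szf : size (fy n) = n.+1 by rewrite size_map_polyC size_genf.
have szm : size (fmid n) = n.+1 by rewrite size_comp_poly2 ?size_mid.
pose N := 2%:R%:P * (fy n - 2%:R%:P * fmid n + fx n).
have N_n : N`_n = (f3_lead n)%:MP%:P.
  rewrite coefCM !coefD coefN coefCM coefC gtn_eqF 1?ltnW // addr0 coef_fmid.
  have -> : (fy n)`_n = 1.
    rewrite coef_map /=; have /eqP := monic_genf n.
    by rewrite lead_coefE size_genf => ->.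
  by rewrite /f3_lead !(rmorphM, rmorphB, rmorph1, rmorph_nat).
have N_neq0 : N`_n != 0 by rewrite N_n polyC_eq0 mpolyC_eq0 f3_lead_neq0.
have szN : size N = n.+1.
  apply/eqP; rewrite eqn_leq; apply/andP; split; last first.
    by rewrite ltnNge; apply: contra N_neq0 => /leq_sizeP/(_ n (leqnn n))->.
  rewrite /N mul_polyC (leq_trans (size_scale_leq _ _)) //.
  rewrite (leq_trans (size_polyD _ _)) // geq_max; apply/andP; split; last first.
    by rewrite (leq_trans (size_polyC_leq1 _)).
  rewrite (leq_trans (size_polyD _ _)) // geq_max szf leqnn size_polyN /=.
  by rewrite mul_polyC (leq_trans (size_scale_leq _ _)) // szm.
have defN : f3 n * ('X - Xin n) ^+ 2 = N by rewrite f3M /N !polyC_natr.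
have monX2 : ('X - Xin n) ^+ 2 \is monic by rewrite monic_exp // monicXsubC.
have lead_f3 : lead_coef (f3 n) = (f3_lead n)%:MP%:P.
  by rewrite -(lead_coef_Mmonic _ monX2) defN lead_coefE szN.
have f3_neq0 : f3 n != 0.
  by rewrite -lead_coef_eq0 lead_f3 polyC_eq0 mpolyC_eq0 f3_lead_neq0.
split=> //; have := congr1 (size \o polyseq) defN; rewrite /= szN size_Mmonic //.
by rewrite size_exp_XsubC addn3 => /(congr1 (fun k => k.-2)).
Qed.

Lemma monic_f1 n : (0 < n)%N -> f1 n \is monic.
Proof.
move=> n_gt0; rewrite monicE.
rewrite -(lead_coef_Mmonic _ (monicXsubC ('X : {poly Qa n}))) [X in lead_coef X]f1M.
have szf : size (fy n) = n.+1 by rewrite size_map_polyC size_genf.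
rewrite lead_coefDl; last first.
  by rewrite size_polyN szf ltnS (leq_trans (size_polyC_leq1 _)).
rewrite lead_coef_map_inj ?raddf0 //; last exact: polyC_inj.
by rewrite (eqP (monic_genf n)).
Qed.

(** * The inner resultant at a root of f *)

(** Here [psi] splits f and sends x to the root [r i]. The leading coefficients of f_1 and f_3 in y
    are nonzero constants, so the resultant commutes with [psi], and f_1 becomes a product of
    distinct linear factors. The sign reflects that f_3 has degree n - 2 in y. *)
Lemma map_resultant_f1_f3 n (S : idomainType)
    (psi : {rmorphism {poly Qa n} -> S}) (r : 'I_n -> S) (i : 'I_n) :
    (1 < n)%N -> injective r -> (forall j, r j != 0) ->
    map_poly (psi \o polyC) (genf n) = \prod_j ('X - (r j)%:P) ->
    psi 'X = r i ->
  psi (resultant (f1 n) (f3 n)) =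
    \prod_(j | j != i) ((-1) ^+ n.-2 *
      \prod_(k | (k != i) && (k != j))
        ((r i + r j) * psi (2%:R^-1)%:MP%:P - r k)).
Proof.
move=> n_gt1 r_inj r_neq0 psi_f psi_X; set F := map_poly _ _ in psi_f.
have [c [def_half cE def_c]] := halfP n; rewrite -def_c; set h := psi c.
have hE : h + h = 1 by rewrite -rmorphD cE rmorph1.
have [lead_f3 sz_f3] := lead_coef_size_f3 n_gt1.
have lead_neq0 : psi (lead_coef (f3 n)) != 0.
  (* On rational constants [psi] is a morphism out of a field, hence injective. *)
  rewrite lead_f3 -[psi _]/((psi \o (polyC \o @mpolyC n rat)) _).
  by rewrite fmorph_eq0 f3_lead_neq0.
rewrite map_resultant_lead //; last first.
  by rewrite (eqP (monic_f1 (ltnW n_gt1))) rmorph1 oner_neq0.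
have map_fy : map_poly psi (fy n) = F by rewrite /fy -map_poly_comp.
have psi_genf : psi (genf n) = F.[r i].
  by rewrite -[in LHS](horner_polyCX (genf n)) -horner_map -/(fy n) map_fy psi_X.
have root_F j : F.[r j] = 0.
  by rewrite psi_f horner_prod (bigD1 j) //= hornerXsubC subrr mul0r.
have map_fx : map_poly psi (fx n) = 0.
  by rewrite map_polyC /= psi_genf root_F.
have map_Xin : map_poly psi (Xin n) = (r i)%:P by rewrite map_polyC /= psi_X.
have map_XsubC : map_poly psi ('X - Xin n) = 'X - (r i)%:P.
  by rewrite rmorphB /= map_polyX map_Xin.
have map_f1 : map_poly psi (f1 n) = \prod_(j | j != i) ('X - (r j)%:P).
  have XsubC_neq0 : 'X - (r i)%:P != 0 by rewrite polyXsubC_eq0.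
  apply: (mulIf XsubC_neq0).
  rewrite -map_XsubC -rmorphM f1M rmorphB /= map_fy map_fx subr0 psi_f.
  by rewrite map_XsubC (bigD1 i) //= mulrC.
set G := map_poly psi (f3 n).
have map_f3 : G * ('X - (r i)%:P) ^+ 2 =
    2%:R * (F - 2%:R * (F \Po (('X + (r i)%:P) * h%:P))).
  have map_fmid : map_poly psi (fmid n) = F \Po (('X + (r i)%:P) * h%:P).
    rewrite /fmid map_comp_poly map_fy def_half.
    by rewrite rmorphM rmorphD /= map_polyX map_Xin map_polyC.
  have /(congr1 (map_poly psi)) := f3M n.
  rewrite rmorphM rmorphXn rmorphM rmorph_nat /= map_XsubC -/G => ->.
  congr (_ * _); rewrite rmorphD rmorphB rmorphM rmorph_nat /=.
  by rewrite map_fy map_fx map_fmid addr0.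
rewrite map_f1.
have -> : \prod_(j | j != i) ('X - (r j)%:P) =
  \prod_(z <- [seq r j | j <- enum (predC1 i)]) ('X - z%:P).
  by rewrite big_map big_enum.
rewrite resultant_prod_XsubC ?map_inj_uniq ?enum_uniq //; last first.
  by apply/mapP=> -[j _ /esym/eqP]; apply/negP.
rewrite big_map big_enum /=; apply: eq_bigr => j neq_ji.
rewrite /G size_map_poly_id0 // sz_f3 -/G; congr (_ * _).
have rji_neq0 : (r j - r i) ^+ 2 != 0.
  by rewrite expf_neq0 // subr_eq0 (inj_eq r_inj).
apply: (mulIf rji_neq0); have := congr1 (horner^~ (r j)) map_f3.
rewrite -!polyC_natr !(hornerM, hornerD, hornerN, horner_exp) horner_comp.
rewrite hornerM hornerD !hornerX !hornerC root_F => ->.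
rewrite psi_f horner_prod (bigD1 i) //= (bigD1 j) //= !hornerXsubC.
rewrite [r j + r i]addrC; under eq_bigr do rewrite hornerXsubC.
set y := (r i + r j) * h; set P := \prod_(k | _) _.
(* The factors k = i and k = j at the midpoint cancel the denominator, and the constants combine to
   2 * (-2) * (-h^2) = (h + h)^2 = 1. *)
have yi : y - r i = h * (r j - r i).
  by rewrite -[X in y - X]mulr1 -hE /y; ring.
have yj : y - r j = - (h * (r j - r i)).
  by rewrite -[X in y - X]mulr1 -hE /y; ring.
rewrite yi yj.
transitivity ((h + h) ^+ 2 * (P * (r j - r i) ^+ 2)); first by ring.
by rewrite hE expr1n mul1r.
Qed.

(** * Points where a nonzero polynomial does not vanish *)

Lemma poly_nonroot (R : numDomainType) (p : {poly R}) :
  p != 0 -> exists x, p.[x] != 0.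
Proof.
move=> p_neq0; pose s := [seq i%:R : R | i <- iota 0 (size p)].
have /allPn[x _ px] : ~~ all (root p) s.
  apply/negP=> /(max_poly_roots p_neq0); rewrite size_map size_iota ltnn.
  by rewrite map_inj_uniq ?iota_uniq => [/(_ isT)|i j /eqP]; rewrite ?eqr_nat => // /eqP.
by exists x.
Qed.

(** A monomial is determined by its last exponent and its restriction to the other variables, so no
    coefficients merge in [muni p]; this shows that [muni] preserves nonvanishing. *)
Lemma muni_coef (R : nzRingType) n (p : {mpoly R[n.+1]}) (m : 'X_{1..n.+1}) :
  ((muni p)`_(m ord_max))@_[multinom m (widen_ord (leqnSn n) i) | i < n] = p@_m.
Proof.
rewrite muniE coef_sum raddf_sum /=.
have E (m' : 'X_{1..n.+1}) :
    ((p@_m' *: 'X_[[multinom m' (widen_ord (leqnSn n) i) | i < n]] *: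
       'X^(m' ord_max))`_(m ord_max))@_
         [multinom m (widen_ord (leqnSn n) i) | i < n]
      = p@_m' * (m == m')%:R.
  rewrite coefZ coefXn -scalerAl mcoeffZ; congr (_ * _).
  case: (m =P m') => [<-|neq_m]; first by rewrite eqxx mulr1 mcoeffX eqxx.
  case: eqP => [eq_max|_]; last by rewrite mulr0 mcoeff0.
  rewrite mulr1 mcoeffX; case: eqP => // eq_w; case: neq_m.
  apply/mnmP=> i; have [->//|neq_i] := eqVneq i ord_max.
  have lt_in : (i < n)%N.
    have := ltn_ord i; rewrite ltnS leq_eqVlt => /orP[/eqP eq_in|//].
    by case/eqP: neq_i; apply: val_inj.
  have := congr1 (fun u : 'X_{1..n} => u (Ordinal lt_in)) eq_w.
  rewrite !mnmE; have -> : widen_ord (leqnSn n) (Ordinal lt_in) = i by exact: val_inj.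
  by [].
under eq_bigr do rewrite E.
have [m_in|m_notin] := boolP (m \in msupp p).
  rewrite (bigD1_seq m) ?msupp_uniq //= eqxx mulr1 big1 ?addr0 // => m' neq_m.
  by rewrite eq_sym (negbTE neq_m) mulr0.
rewrite (memN_msupp_eq0 m_notin) big_seq big1 // => m' m'_in.
case: eqP => [eq_m|_]; last by rewrite mulr0.
by rewrite eq_m m'_in in m_notin.
Qed.

Lemma meval_muni (R : comNzRingType) n (p : {mpoly R[n.+1]}) (v : 'I_n.+1 -> R) :
  p.@[v] =
  (map_poly (meval (fun i => v (widen_ord (leqnSn n) i))) (muni p)).[v ord_max].
Proof.
rewrite muniE mevalE raddf_sum horner_sum; apply: eq_bigr => m _.
rewrite /= map_polyZ /= map_polyXn hornerZ hornerXn mevalZ mevalX -mulrA.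
congr (_ * _); rewrite big_ord_recr /=; congr (_ * _).
by apply: eq_bigr => i _; rewrite mnmE.
Qed.

(** Induction on the number of variables: choose the first ones so that some coefficient in the last
    variable stays nonzero, then choose the last one. *)
Lemma mpoly_nonroot (R : numDomainType) n (p : {mpoly R[n]}) :
  p != 0 -> exists v, p.@[v] != 0.
Proof.
elim: n p => [|n IHn] p p_neq0.
  exists (fun=> 0); rewrite (nvar0_mpolyC p) mevalC.
  by apply: contraNneq p_neq0 => p0; rewrite (nvar0_mpolyC p) p0.
have muni_neq0 : (muni p)`_(mlead p ord_max) != 0.
  apply: contraTneq p_neq0 => p0; rewrite negbK -mleadc_eq0 -muni_coef p0.
  by rewrite mcoeff0.
have [v pv] := IHn _ muni_neq0.
have map_neq0 : map_poly (meval v) (muni p) != 0.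
  apply: contraNneq pv => /(congr1 (coefp (mlead p ord_max))).
  by rewrite /= coef_map coef0 => ->.
have [x px] := poly_nonroot map_neq0.
pose w (i : 'I_n.+1) := if insub (val i) is Some j then v j else x.
exists w; rewrite meval_muni.
have -> : w ord_max = x by rewrite /w insubF //= ltnn.
rewrite (_ : map_poly _ _ = map_poly (meval v) (muni p)) //.
apply: eq_map_poly => q; rewrite !mevalE; apply: eq_bigr => m _; congr (_ * _).
apply: eq_bigr => i _; congr (_ ^+ _); rewrite /w insubT //= => lt_in.
by congr (v _); apply: val_inj.
Qed.

(** * Top coefficients along a line *)

(** The coefficient [c] may be 0, which makes the notion multiplicative over any commutative
    ring. *)
Definition has_top_coef (R : nzRingType) d (c : R) (p : {poly R}) :=
  (size p <= d.+1)%N /\ p`_d = c.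

Lemma has_top_coefM (R : comNzRingType) d d' (c c' : R) (p q : {poly R}) :
  has_top_coef d c p -> has_top_coef d' c' q ->
  has_top_coef (d + d') (c * c') (p * q).
Proof.
move=> [sz_p <-] [sz_q <-]; split.
  apply: (leq_trans (size_polyMleq _ _)).
  by rewrite -subn1 leq_subLR add1n -addnS -addSn leq_add.
have lt_d : (d < (d + d').+1)%N by rewrite ltnS leq_addr.
rewrite coefM (bigD1 (Ordinal lt_d)) //= addKn big1 ?addr0 // => i neq_id.
have [lt_id|] := ltnP i d.
  rewrite [q`_ _]nth_default ?mulr0 // (leq_trans sz_q) //.
  by rewrite ltn_subRL ltn_add2r.
rewrite leq_eqVlt => /orP[/eqP eq_d|lt_di].
  by case/eqP: neq_id; apply: val_inj.
by rewrite nth_default ?mul0r // (leq_trans sz_p).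
Qed.

Lemma has_top_coef1 (R : comNzRingType) : has_top_coef 0 (1 : R) 1.
Proof. by split; rewrite ?size_poly1 ?coef1. Qed.

Lemma has_top_coefX (R : comNzRingType) k d (c : R) (p : {poly R}) :
  has_top_coef d c p -> has_top_coef (d * k) (c ^+ k) (p ^+ k).
Proof.
move=> top_p; elim: k => [|k IHk]; first by rewrite muln0; exact: has_top_coef1.
by rewrite mulnS !exprS; apply: has_top_coefM.
Qed.

Lemma has_top_coef_prod (R : comNzRingType) n (d : 'I_n -> nat) (c : 'I_n -> R)
    (p : 'I_n -> {poly R}) :
  (forall i, has_top_coef (d i) (c i) (p i)) ->
  has_top_coef (\sum_i d i) (\prod_i c i) (\prod_i p i).
Proof.
move=> top_p; elim/big_rec3: _ => [|i q e f _ IH]; first exact: has_top_coef1.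
exact: has_top_coefM.
Qed.

(* Along a line a = b + t c, the coefficient of t^d, where d is the total degree,
   is the value at c of the homogeneous part of degree d. *)
Lemma mmap_line n (A R : comNzRingType) (f : {rmorphism A -> R})
    (b c : 'I_n -> R) (p : {mpoly A[n]}) d :
  (msize p <= d.+1)%N ->
  has_top_coef d (\sum_(m <- msupp p | mdeg m == d) f p@_m * mmap1 c m)
    (mmap (polyC \o f) (fun i => (b i)%:P + c i *: 'X) p).
Proof.
move=> le_pd; pose g i := (b i)%:P + c i *: 'X.
have top_g i : has_top_coef 1 (c i) (g i).
  split; last by rewrite coefD coefC coefZ coefX /= add0r mulr1.
  rewrite (leq_trans (size_polyD _ _)) // geq_max.
  rewrite (leq_trans (size_polyC_leq1 _)) //=.
  by rewrite (leq_trans (size_scale_leq _ _)) // size_polyX.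
have top_m m : has_top_coef (mdeg m) (mmap1 c m) (mmap1 g m).
  rewrite mdegE; apply: has_top_coef_prod => i.
  by have := has_top_coefX (m i) (top_g i); rewrite mul1n.
have mdeg_le m : m \in msupp p -> (mdeg m <= d)%N.
  by move=> /msize_mdeg_lt lt_m; rewrite -ltnS (leq_trans lt_m).
split.
  rewrite /mmap big_seq (leq_trans (size_sum _ _ _)) //.
  apply/bigmax_leqP_seq => m m_in _; rewrite /= mul_polyC.
  rewrite (leq_trans (size_scale_leq _ _)) //.
  by have [sz_m _] := top_m m; rewrite (leq_trans sz_m) // ltnS mdeg_le.
rewrite /mmap coef_sum [RHS]big_mkcond /= !big_seq; apply: eq_bigr => m m_in.
rewrite coefCM; have [sz_m coef_m] := top_m m.
case: eqP => [<-|/eqP neq_d]; first by rewrite coef_m.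
rewrite nth_default ?mulr0 // (leq_trans sz_m) //.
by rewrite ltn_neqAle neq_d mdeg_le.
Qed.

Lemma mmap_comp_mmap n k (A : nzRingType) (B R : comNzRingType)
    (f : {rmorphism A -> B}) (g : {rmorphism B -> R})
    (u : 'I_n -> {mpoly B[k]}) (v : 'I_k -> R) (p : {mpoly A[n]}) :
  mmap g v (mmap (@mpolyC k B \o f) u p) = mmap (g \o f) (mmap g v \o u) p.
Proof.
rewrite [X in mmap g v X]/mmap raddf_sum /=; apply: eq_bigr => m _.
rewrite rmorphM /= mmapC; congr (_ * _); rewrite rmorph_prod.
by apply: eq_bigr => i _; rewrite rmorphXn.
Qed.

(** * The product formula for E *)

Definition root_poly (R : nzRingType) n (r : 'I_n -> R) : {poly R} :=
  \prod_j ('X - (r j)%:P).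

Lemma size_root_poly (R : nzRingType) n (r : 'I_n -> R) :
  size (root_poly r) = n.+1.
Proof. by rewrite /root_poly size_prod_XsubC /index_enum -enumT size_enum_ord. Qed.

Lemma monic_root_poly (R : nzRingType) n (r : 'I_n -> R) : root_poly r \is monic.
Proof. exact: monic_prod_XsubC. Qed.

(* Injective because the elementary symmetric polynomials are algebraically
   independent. *)
Definition viete n : {mpoly rat[n]} -> {mpoly rat[n]} :=
  mmap (@mpolyC n rat) (fun i => (root_poly (fun j : 'I_n => 'X_j))`_i).

HB.instance Definition _ n := GRing.RMorphism.on (@viete n).

Lemma viete_genf n : map_poly (@viete n) (genf n) = root_poly (fun j => 'X_j).
Proof.
apply/polyP=> i; rewrite coef_map /=; have [lt_in|] := ltnP i n.
  by rewrite -[i]/(val (Ordinal lt_in)) coef_genf /viete mmapX mmap1U.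
rewrite leq_eqVlt => /orP[/eqP<-|lt_ni].
  have /eqP := monic_genf n; rewrite lead_coefE size_genf => ->.
  have /eqP := monic_root_poly (fun j : 'I_n => 'X_j : {mpoly rat[n]}).
  by rewrite lead_coefE size_root_poly => ->; rewrite rmorph1.
by rewrite !nth_default ?rmorph0 ?size_genf ?size_root_poly.
Qed.

Lemma viete_coef n (i : 'I_n) :
  (root_poly (fun j : 'I_n => 'X_j : {mpoly rat[n]}))`_i =
    (-1) ^+ (n - i) * mesym n rat (n - i).
Proof.
have lt_ni : (n - i < n.+1)%N by rewrite ltnS leq_subr.
have := mroots_coeff [tuple ('X_j : {mpoly rat[n]}) | j < n] (Ordinal lt_ni).
have <- : root_poly (fun j : 'I_n => 'X_j : {mpoly rat[n]}) =
    \prod_(c <- [tuple ('X_j : {mpoly rat[n]}) | j < n]) ('X - c%:P).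
  by rewrite /root_poly big_tuple; apply: eq_bigr => j _; rewrite tnth_mktuple.
rewrite /= subKn 1?ltnW // => ->.
congr (_ * _); rewrite /mesym raddf_sum /=; apply: eq_bigr => h _.
rewrite rmorph_prod; apply: eq_bigr => j _.
by rewrite /= mevalXU tnth_mktuple.
Qed.

Lemma viete_inj n : injective (@viete n).
Proof.
apply: raddf_inj => p viete_p0.
(* The coefficients of [root_poly] are the elementary symmetric polynomials up to sign and reversal
   of indices. The substitution [t] accounts for both, and [w] is its inverse. *)
pose t (i : 'I_n) : {mpoly rat[n]} := (-1) ^+ (n - i) * 'X_(rev_ord i).
pose w (i : 'I_n) : {mpoly rat[n]} := (-1) ^+ (n - rev_ord i) * 'X_(rev_ord i).
have tE v i : mmap (@mpolyC n rat) v (t i) = (-1) ^+ (n - i) * v (rev_ord i).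
  by rewrite rmorphM rmorphXn rmorphN1 /= mmapX mmap1U.
have q0 : mmap (@mpolyC n rat) t p = 0.
  apply: msym_fundamental_un0; rewrite -[RHS]viete_p0.
  rewrite /comp_mpoly (mmap_comp_mmap idfun (@mpolyC n rat)) /viete /mmap.
  apply: eq_bigr => m _; congr (_ * _); apply: eq_bigr => i _; congr (_ ^+ _).
  by rewrite viete_coef -[LHS]/(mmap _ _ (t i)) tE tnth_mktuple /= subnSK.
have := mmap_comp_mmap idfun (@mpolyC n rat) t w p.
rewrite [X in mmap _ _ X]q0 raddf0 => /esym <-.
rewrite -[LHS]comp_mpoly_id /comp_mpoly /mmap; apply: eq_bigr => m _.
congr (_ * _); apply: eq_bigr => i _; congr (_ ^+ _).
rewrite tnth_mktuple -[RHS]/(mmap _ _ (t i)) tE /w rev_ordK.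
by rewrite mulrA -exprD addnn -mul2n exprM sqrrN !expr1n mul1r.
Qed.

(** The value of E up to sign in terms of the roots; [h] stands for the image of 1/2, as [R] need
    not have inverses. *)
Definition midpoint_prod (R : comNzRingType) n (h : R) (r : 'I_n -> R) : R :=
  \prod_i \prod_(j | j != i) \prod_(k | (k != i) && (k != j))
    ((r i + r j) * h - r k).

(** Since k differs from i and j, each factor has coefficient -1 at the variable of index k. *)
Lemma midpoint_prod_X_neq0 n (h : rat) :
  midpoint_prod h%:MP (fun i => 'X_i : {mpoly rat[n]}) != 0.
Proof.
apply/prodf_neq0=> i _; apply/prodf_neq0=> j _; apply/prodf_neq0=> k /andP[ki kj].
apply/negP=> /eqP/(congr1 (mcoeff U_(k))); rewrite mcoeffB mcoeff0 mulrC mul_mpolyC.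
rewrite mcoeffZ mcoeffD !mcoeffXU eqxx ![_ == k]eq_sym (negbTE ki) (negbTE kj).
by rewrite addr0 mulr0 sub0r => /eqP; rewrite oppr_eq0 oner_eq0.
Qed.

(** The generic roots are distinct and nonzero, as the resultant formula requires, and injectivity
    of [viete] keeps leading coefficients nonzero. The exponent [e] is left implicit because it
    involves the degree of the inner resultant. *)
Lemma viete_Eres n : (1 < n)%N ->
  exists e, viete (Eres n) =
    (-1) ^+ e * midpoint_prod (2%:R^-1)%:MP (fun i => 'X_i : {mpoly rat[n]}).
Proof.
move=> n_gt1; pose r (i : 'I_n) : {mpoly rat[n]} := 'X_i.
have r_inj : injective r.
  move=> i j /(congr1 (mcoeff U_(j))) /eqP; rewrite !mcoeffXU eqxx eqr_nat.
  by rewrite eqb1 => /eqP.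
have r_neq0 i : r i != 0.
  apply/negP=> /eqP/(congr1 (mcoeff U_(i))); rewrite mcoeffXU mcoeff0 eqxx => /eqP.
  by rewrite oner_eq0.
pose T i : {mpoly rat[n]} := \prod_(j | j != i) \prod_(k | (k != i) && (k != j))
    ((r i + r j) * (2%:R^-1)%:MP - r k).
have T_neq0 i : T i != 0.
  have := midpoint_prod_X_neq0 n 2%:R^-1.
  by move/prodf_neq0/(_ i isT).
set Rs := resultant (f1 n) (f3 n).
have RsE i : (map_poly (@viete n) Rs).[r i] = (-1) ^+ (n.-2 * n.-1) * T i.
  pose psi : {rmorphism {poly Qa n} -> {mpoly rat[n]}} :=
    (horner_eval (r i) \o map_poly (@viete n)).
  have psiE : psi \o polyC =1 @viete n.
    by move=> c; rewrite /= /horner_eval map_polyC hornerC.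
  have := @map_resultant_f1_f3 n _ psi r i n_gt1 r_inj r_neq0.
  rewrite (eq_map_poly psiE) viete_genf => /(_ erefl).
  have -> : psi 'X = r i by rewrite /= /horner_eval map_polyX hornerX.
  move=> /(_ erefl) psiR; rewrite -[LHS]/(psi Rs) psiR.
  have -> : psi (2%:R^-1)%:MP%:P = (2%:R^-1)%:MP.
    move: (2%:R^-1 : rat) => c.
    by rewrite -[LHS]/((psi \o polyC) c%:MP) psiE /viete mmapC.
  by rewrite big_split /= prodr_const cardC1 card_ord exprM.
(* Only a nonzero inner resultant has a leading coefficient that survives [viete]. *)
have Rs_neq0 : Rs != 0.
  have i : 'I_n by exact: Ordinal (ltnW n_gt1).
  apply: contraNneq (T_neq0 i) => Rs0; have := RsE i.
  by rewrite Rs0 rmorph0 horner0 => /esym/eqP; rewrite mulf_eq0 signr_eq0.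
have viete_neq0 (p : {mpoly rat[n]}) : p != 0 -> viete p != 0.
  by apply: contra_neq => vp0; apply: (@viete_inj n); rewrite vp0 rmorph0.
rewrite /Eres map_resultant_lead ?viete_neq0 ?lead_coef_eq0 //; last first.
  by rewrite monic_neq0 // monic_genf.
rewrite viete_genf.
have -> : root_poly r = \prod_(z <- [seq r j | j <- enum 'I_n]) ('X - z%:P).
  by rewrite big_map big_enum.
have rs_uniq : uniq [seq r j | j <- enum 'I_n].
  by rewrite (map_inj_uniq r_inj) enum_uniq.
rewrite resultant_prod_XsubC //; last first.
  by apply/mapP=> -[j _ /esym/eqP]; apply/negP.
rewrite big_map big_enum /=; under eq_bigr do rewrite RsE mulrA -exprD.
rewrite big_split /= prodr_const -exprM; eexists; reflexivity.
Qed.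

Lemma Eres_neq0 n : (1 < n)%N -> Eres n != 0.
Proof.
move=> /viete_Eres[e]; apply: contra_eq_neq => ->; rewrite rmorph0 eq_sym.
by rewrite mulf_neq0 ?signr_eq0 // midpoint_prod_X_neq0.
Qed.

(** Substituting [r i] for the generic roots carries the identity over to any roots, repeated or
    zero ones included. *)
Lemma mmap_Eres n (R : comNzRingType) (f : {rmorphism rat -> R}) (r : 'I_n -> R) :
  (1 < n)%N ->
  exists e, mmap f (fun i => (root_poly r)`_i) (Eres n) =
    (-1) ^+ e * midpoint_prod (f 2%:R^-1) r.
Proof.
move=> /viete_Eres[e def_E]; exists e.
have mmapXE i : mmap f r 'X_i = r i by rewrite mmapX mmap1U.
have map_root_poly : map_poly (mmap f r) (root_poly (fun j => 'X_j)) = root_poly r.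
  rewrite rmorph_prod /=; apply: eq_bigr => j _.
  by rewrite rmorphB /= map_polyX map_polyC /= mmapXE.
have -> : mmap f (fun i => (root_poly r)`_i) (Eres n) = mmap f r (viete (Eres n)).
  rewrite /viete (mmap_comp_mmap idfun f) /mmap; apply: eq_bigr => m _.
  congr (_ * _); apply: eq_bigr => i _; congr (_ ^+ _).
  by rewrite -map_root_poly coef_map.
rewrite def_E rmorphM rmorphXn rmorphN1; congr (_ * _).
move: (2%:R^-1 : rat) => c.
rewrite rmorph_prod; apply: eq_bigr => i _; rewrite rmorph_prod.
apply: eq_bigr => j _; rewrite rmorph_prod; apply: eq_bigr => k _.
by rewrite rmorphB rmorphM rmorphD /= !mmapXE mmapC.
Qed.

(** * The degree of the product over triples in one moving root *)

Lemma predn_size_prod (R : idomainType) (I : finType) (P : pred I) (F : I -> {poly R}) :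
  (forall i, P i -> F i != 0) ->
  (size (\prod_(i | P i) F i)).-1 = (\sum_(i | P i) (size (F i)).-1)%N.
Proof.
move=> F_neq0; suff [] : \prod_(i | P i) F i != 0 /\
    (size (\prod_(i | P i) F i)).-1 = (\sum_(i | P i) (size (F i)).-1)%N by [].
elim/big_rec2: _ => [|i d p Pi [p_neq0 <-]]; first by rewrite oner_neq0 size_poly1.
split; first by rewrite mulf_neq0 ?F_neq0.
rewrite size_mul ?F_neq0 //; move: (F_neq0 i Pi) p_neq0.
by rewrite -!size_poly_gt0; lia.
Qed.

(** The index 0 takes one of three positions, and the other two entries form an ordered pair of
    distinct nonzero indices: n (n - 1) choices. *)
Lemma count_triples_with_zero n :
  (\sum_(i < n.+1) \sum_(j < n.+1 | j != i)
     \sum_(k < n.+1 | (k != i) && (k != j))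
       ((i == ord0) + (j == ord0) + (k == ord0)) = 3 * n * n.-1)%N.
Proof.
have cardC2 (i j : 'I_n.+1) : j != i -> #|[pred k | (k != i) && (k != j)]| = n.-1.
  move=> neq_ji; have := cardC (pred2 i j); rewrite card2 eq_sym neq_ji card_ord.
  rewrite (@eq_card _ [predC pred2 i j] [pred k | (k != i) && (k != j)]); last first.
    by move=> k; rewrite !inE negb_or.
  by rewrite add2n => /(congr1 (fun d => d.-2)).
(* If i or j is 0, all n - 1 values of k count; otherwise only k = 0 does. *)
have inner (i j : 'I_n.+1) : j != i ->
  (\sum_(k < n.+1 | (k != i) && (k != j)) ((i == ord0) + (j == ord0) + (k == ord0)) =
  ((i == ord0) + (j == ord0)) * n.-1 + ((i != ord0) && (j != ord0)))%N.
  move=> neq_ji; rewrite big_split /= sum_nat_const cardC2 // mulnC; congr (_ + _)%N.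
  have [/andP[i0 j0]|] := boolP ((i != ord0) && (j != ord0)).
    rewrite (bigD1 ord0) /=; last by rewrite eq_sym i0 eq_sym j0.
    by rewrite big1 // => k /andP[_ /negbTE->].
  move=> ij0; rewrite big1 // => k /andP[ki kj]; case: eqP => // k0.
  by rewrite -k0 ![_ == k]eq_sym ki kj in ij0.
under eq_bigr => i _ do under eq_bigr => j neq_ji do rewrite inner //.
rewrite (bigD1 ord0) //= (eq_bigr (fun=> n.-1)); last first.
  by move=> j /negbTE->; rewrite !addn0 mul1n.
rewrite sum_nat_const cardC1 card_ord (eq_bigr (fun=> (2 * n.-1)%N)).
  by rewrite sum_nat_const cardC1 card_ord; lia.
move=> i i_neq0; rewrite (bigD1 ord0) /=; last by rewrite eq_sym.
rewrite (negbTE i_neq0) andbF addn0 mul1n (eq_bigr (fun=> 1%N)).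
  by rewrite sum_nat_const muln1 -/(index_enum _) cardC2 1?eq_sym //; lia.
by move=> j /andP[_ j_neq0]; rewrite (negbTE j_neq0).
Qed.

(** Only the root of index 0 moves. The coefficient of t in a factor is 1/2 if i or j is 0, -1 if k
    is 0, and 0 otherwise, so the factor has degree 1 exactly for the triples containing 0. *)
Lemma size_midpoint_prod (F : numFieldType) n (s g : 'I_n.+1 -> _) :
  (forall i, g i = ((i == ord0)%:R : F) *: 'X + (s i)%:P) ->
  midpoint_prod (2%:R^-1)%:P g != 0 ->
  (size (midpoint_prod (2%:R^-1)%:P g)).-1 = (3 * n * n.-1)%N.
Proof.
move=> gE /prodf_neq0 P_neq0.
rewrite -count_triples_with_zero predn_size_prod //; apply: eq_bigr => i _.
have /prodf_neq0 Pi_neq0 := P_neq0 i isT.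
rewrite predn_size_prod //; apply: eq_bigr => j neq_ji.
have /prodf_neq0 Pij_neq0 := Pi_neq0 j neq_ji.
rewrite predn_size_prod //; apply: eq_bigr => k neq_k.
pose h : F := 2%:R^-1.
pose a : F := ((i == ord0)%:R + (j == ord0)%:R) * h - (k == ord0)%:R.
pose b := (s i + s j) * h - s k.
have -> : (g i + g j) * h%:P - g k = a%:P * 'X + b%:P.
  by rewrite !gE /a /b -!mul_polyC !(rmorphD, rmorphB, rmorphM, rmorphN) /=; ring.
have -> : (size (a%:P * 'X + b%:P)).-1 = (a != 0).
  rewrite size_MXaddC polyC_eq0; have [->|a_neq0] := eqVneq a 0.
    by case: eqP; rewrite /= ?size_poly0.
  by rewrite /= size_polyC a_neq0.
have h_neq0 : h != 0 by rewrite invr_eq0 pnatr_eq0.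
rewrite /a; case: (eqVneq i ord0) neq_ji neq_k => [->|_].
  by move=> /negbTE-> /andP[/negbTE-> _]; rewrite addr0 mul1r subr0 h_neq0.
case: (eqVneq j ord0) => [-> _|_ _].
  by move=> /andP[_ /negbTE->]; rewrite add0r mul1r subr0 h_neq0.
by move=> _; rewrite addr0 mul0r sub0r oppr_eq0 pnatr_eq0; case: (k == ord0).
Qed.

(** * The line of polynomials (x - t) h(x) and the total degree of E *)

(** The polynomial is (x - t) h(x) with h = [root_poly s], whence the coefficients h_(i-1) - t h_i,
    affine in t. *)
Lemma root_poly_line (F : fieldType) n (s : 'I_n -> F) (i : nat) :
  (root_poly (fun j : 'I_n.+1 =>
     if unlift ord0 j is Some j' then (s j')%:P else 'X))`_i =
  (if i is i'.+1 then (root_poly s)`_i' else 0)%:P - (root_poly s)`_i *: 'X.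
Proof.
rewrite /root_poly big_ord_recl unlift_none.
have -> : \prod_(j < n) ('X - (if unlift ord0 (lift ord0 j) is Some j'
    then (s j')%:P else 'X)%:P) = map_poly polyC (root_poly s).
  rewrite rmorph_prod; apply: eq_bigr => j _.
  by rewrite liftK rmorphB /= map_polyX map_polyC.
rewrite mulrBl coefB coefXM coefCM !coef_map /= -mul_polyC [_ * 'X]mulrC.
by case: i => [|i].
Qed.

(* msize p = 1 + total degree of p (and 0 for p = 0) *)
Theorem corollary3 (n : nat) (hn : (3 <= n)%N) :
  msize (Eres n) = (3 * (n - 1) * (n - 2)).+1.
Proof.
case: n hn => // n n_ge2; set E := Eres n.+1.
have E_neq0 : E != 0 by rewrite Eres_neq0 // ltnW.
pose d := mdeg (mlead E); have sz_E : msize E = d.+1 by rewrite mlead_deg.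
(* [H] is the homogeneous part of [E] of top degree. *)
pose H := \sum_(m <- msupp E | mdeg m == d) E@_m *: 'X_[m].
have H_neq0 : H != 0.
  apply/negP=> /eqP/(congr1 (mcoeff (mlead E))) /eqP; rewrite mcoeff0 raddf_sum /=.
  rewrite big_mkcond (bigD1_seq (mlead E)) ?mlead_supp ?msupp_uniq //= big1.
    by rewrite eqxx mcoeffZ mcoeffX eqxx mulr1 addr0 mleadc_eq0 (negbTE E_neq0).
  by move=> m /negbTE neq_m; rewrite mcoeffZ mcoeffX neq_m mulr0 if_same.
(* The extra variable forces the last coordinate of [v] to be nonzero, so that dividing by it makes
   h monic. *)
have [|v] := @mpoly_nonroot _ _ (H * 'X_ord_max).
  by rewrite mulf_neq0 // -msize_poly_eq0 msizeX.
rewrite mevalM mevalXU mulf_eq0 negb_or => /andP[Hv v_neq0].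
pose u i := v (inord i) / v ord_max.
(* h is taken over [algC], where it splits; its roots are the constant roots of the line. *)
pose hC : {poly algC} := \poly_(i < n.+1) ratr (u i).
have u_n : u n = 1.
  by rewrite /u (_ : inord n = ord_max) ?divff //; apply: val_inj; rewrite /= inordK.
have sz_h : size hC = n.+1 by rewrite size_poly_eq //= u_n rmorph1 oner_neq0.
have mon_h : hC \is monic.
  by rewrite monicE lead_coefE sz_h coef_poly ltnSn u_n rmorph1.
have [rs def_h] := closed_field_poly_normal hC.
rewrite (eqP mon_h) scale1r in def_h.
have sz_rs : size rs = n by apply: succn_inj; rewrite -sz_h def_h size_prod_XsubC.
pose s (j : 'I_n) := rs`_j.
have {}def_h : hC = root_poly s.
  by rewrite def_h /root_poly (big_nth 0) big_mkord sz_rs.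
pose g (j : 'I_n.+1) : {poly algC} :=
  if unlift ord0 j is Some j' then (s j')%:P else 'X.
pose b (i : 'I_n.+1) := if val i is i'.+1 then (root_poly s)`_i' else 0.
pose c (i : 'I_n.+1) : algC := - ratr (v i / v ord_max).
have coef_g (i : 'I_n.+1) : (root_poly g)`_i = (b i)%:P + c i *: 'X.
  rewrite root_poly_line /b; congr (_ + _).
  by rewrite -def_h coef_poly ltn_ord /u inord_val /c scaleNr.
have [e] := @mmap_Eres n.+1 _ (polyC \o ratr) g (ltnW n_ge2).
have -> : mmap (polyC \o ratr) (fun i => (root_poly g)`_i) E =
    mmap (polyC \o ratr) (fun i => (b i)%:P + c i *: 'X) E.
  rewrite /mmap; apply: eq_bigr => m _; congr (_ * _); apply: eq_bigr => i _.
  by rewrite coef_g.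
have [] := @mmap_line _ _ _ (ratr : {rmorphism rat -> algC}) b c E d.
  by rewrite sz_E.
set Q := mmap _ _ E => sz_Q top_Q def_Q.
(* The direction [c] is [v] scaled by the inverse of minus its last coordinate; homogeneity of [H]
   pulls out the d-th power of this scalar. *)
have topE : Q`_d = (- ratr (v ord_max)^-1) ^+ d * ratr H.@[v].
  have -> : H.@[v] =
      \sum_(m <- msupp E | mdeg m == d) E@_m * \prod_i v i ^+ m i.
    by rewrite /H raddf_sum; apply: eq_bigr => m _; rewrite /= mevalZ mevalX.
  rewrite top_Q rmorph_sum mulr_sumr /=; apply: eq_bigr => m /eqP deg_m.
  rewrite rmorphM mulrCA; congr (_ * _).
  rewrite -deg_m mdegE -prodrXr rmorph_prod -big_split /=.
  apply: eq_bigr => i _; rewrite rmorphXn -exprMn /c rmorphM /=; congr (_ ^+ _).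
  by rewrite mulNr mulrC.
have Qd_neq0 : Q`_d != 0.
  rewrite topE mulf_neq0 ?expf_neq0 ?oppr_eq0 ?fmorph_eq0 ?invr_eq0 //.
have size_Q : size Q = d.+1.
  apply/eqP; rewrite eqn_leq sz_Q ltnNge.
  by apply: contra Qd_neq0 => /leq_sizeP/(_ d (leqnn d))->.
have Q_neq0 : Q != 0 by rewrite -size_poly_eq0 size_Q.
have halfC : (polyC \o ratr) (2%:R^-1 : rat) = (2%:R^-1)%:P :> {poly algC}.
  by rewrite /= fmorphV rmorph_nat.
have {}def_Q : Q = (-1) ^+ e * midpoint_prod (2%:R^-1)%:P g.
  by rewrite def_Q; congr (_ * midpoint_prod _ _); exact: halfC.
have P_neq0 : midpoint_prod (2%:R^-1)%:P g != 0.
  by apply: contraNneq Q_neq0 => P0; rewrite def_Q P0 mulr0.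
(* The moving root is t + 0, so [s] is extended by 0 at index 0. *)
pose s' j := if unlift ord0 j is Some j' then s j' else 0.
have := size_midpoint_prod (s := s') _ P_neq0.
have sz_QP : size Q = size (midpoint_prod (2%:R^-1)%:P g).
  by rewrite def_Q -signr_odd mulr_sign; case: ifP; rewrite ?size_polyN.
rewrite -sz_QP size_Q /= sz_E subSS subn0 subSS subn1 => -> //.
move=> j; rewrite /g /s'; case: unliftP => [j' ->|->].
  by rewrite eq_sym (negbTE (neq_lift _ _)) scale0r add0r.
by rewrite eqxx scale1r addr0.
Qed.
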